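(* For a positive integer $n$, let $\mathcal{L}^{T(2,2n)}$ be the set of all oriented diagrams on $S^2$ of the $(2,2n)$-torus link $T(2,2n)$. Let $n$ and $m$ be positive integers. If $n\neq m$, then $\hat f(\mathcal{L}^{T(2,2n)})\neq \hat f(\mathcal{L}^{T(2,2m)})$.
   Context: Link diagrams are on the two-sphere $S^2$; a diagram of a two-component link is written $D=K_1\cup K_2$ with its knot components ordered. Links are considered up to mirror image, so a diagram of $T(2,2n)$ may represent $T(2,2n)$ or its mirror image, with any orientation. A non-self crossing is a crossing between distinct components. The non-self OU sequence $\hat f(K_i)$ is the cyclic sequence (sequence up to cyclic rotation, possibly empty) of letters $O$ and $U$ obtained by traversing $K_i$ along its orientation and recording, at each non-self crossing met, $O$ if $K_i$ passes over and $U$ if $K_i$ passes under (self-crossings are ignored). Put $\hat f(D)=(\hat f(K_1),\hat f(K_2))$, and for a set $\mathcal{S}$ of diagrams put $\hat f(\mathcal{S})=\{\hat f(D)\mid D\in\mathcal{S}\}$. *)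

(* Defs.v *)
From HB Require Import structures.
From Stdlib Require Export Relation_Operators.
From mathcomp Require Export all_boot fingroup perm.
From mathcomp Require Export generic_quotient.
From mathcomp Require Export classical_sets.

Set Implicit Arguments.
Unset Strict Implicit.
Unset Printing Implicit Defensive.

(* Oriented link diagrams on the (oriented) two-sphere, up to orientation-     *)
(* preserving homeomorphism of the sphere, are encoded by their signed Gauss   *)
(* codes; links are isotopy classes, that is, diagrams modulo Reidemeister     *)
(* moves.  A "passage" (c, b) is the event of a component running through the  *)
(* crossing c, over if b = true and under if b = false.                        *)
Notation passage X := (X * bool)%type.

Record gauss_code := GaussCode {
  crossings : nat;
  crossing : finType := 'I_crossings;
  next : {perm passage crossing};   (* the passage met next on the component *)
  sign : crossing -> bool;          (* true for a positive crossing *)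
  (* A component without any passage is a circle free of crossings. *)
  comp : passage crossing -> 'I_2
}.
Arguments sign : clear implicits.
Arguments comp : clear implicits.

Section Surface.
Variable G : gauss_code.
Implicit Types (c : crossing G) (p : passage (crossing G)).

(* Half-edges of the underlying 4-valent graph: (p, true) leaves the crossing  *)
(* of p along the strand of p, and (p, false) enters it.                       *)
Definition half_edge : finType := (passage (crossing G) * bool)%type.

Definition opposite (d : half_edge) : half_edge :=
  if d.2 then (next G d.1, false) else ((next G)^-1%g d.1, true).

(* The next half-edge counterclockwise around a crossing.  The cyclic order is *)
(* over-out, under-out, over-in, under-in at a positive crossing, and          *)
(* over-out, under-in, over-in, under-out at a negative one.                   *)
Definition rotate (d : half_edge) : half_edge :=
  let: ((c, b), out) := d in ((c, ~~ b), out (+) (sign G c (+) b)).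

(* The orbits of face_step are the boundary walks of the faces. *)
Definition face_step (d : half_edge) : half_edge := rotate (opposite d).

Definition adjacent c1 c2 : bool :=
  [exists b1, exists b2,
     (next G (c1, b1) == (c2, b2)) || (next G (c2, b2) == (c1, b1))].

Definition comp_correct : Prop :=
  forall p q, (comp G p == comp G q) = fconnect (next G) p q.

(* Euler's formula V - E + F = 2 * #pieces with E = 2 * V: every connected     *)
(* piece of the diagram is drawn on a sphere.  For a disconnected diagram the  *)
(* code does not record which faces of the pieces are merged; all choices are  *)
(* diagrams of the same split link.                                            *)
Definition spherical : Prop :=
  fcard face_step predT = #|crossing G| + 2 * n_comp adjacent predT.

End Surface.

Record diagram := Diagram {
  code :> gauss_code;
  _ : comp_correct code;
  _ : spherical code
}.

Definition cyc_rel (s t : seq bool) : bool :=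
  has (fun i => rot i s == t) (iota 0 (size s).+1).

Lemma cyc_relP s t : reflect (exists i, rot i s = t) (cyc_rel s t).
Proof.
apply: (iffP hasP) => [[i _ /eqP <-]|[i <-]]; first by exists i.
exists (minn i (size s)); last by rewrite -rot_minn.
by rewrite mem_iota add0n ltnS geq_minr.
Qed.

Lemma cyc_rel_equiv : equiv_class_of cyc_rel.
Proof.
have sym s t : cyc_rel s t -> cyc_rel t s.
  case/cyc_relP=> i <-; apply/cyc_relP; exists (size (rot i s) - i).
  exact: rotK.
split=> [s|s t|t s u]; first by apply/cyc_relP; exists 0; rewrite rot0.
  by apply/idP/idP; apply: sym.
case/cyc_relP=> i <- /cyc_relP[j <-]; apply/cyc_relP.
by exists (rot_add s i j); rewrite rot_rot_add.
Qed.

Canonical cyc_equiv := EquivRelPack cyc_rel_equiv.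

(* Cyclic words in the letters O = true and U = false *)
Definition cyclic_word := {eq_quot cyc_equiv}%qT.

Definition nonself (G : gauss_code) (c : crossing G) : bool :=
  comp G (c, true) != comp G (c, false).

(* The component i is read off from an arbitrary starting point. *)
Definition ou_word (G : gauss_code) (i : 'I_2) : seq bool :=
  if [pick p | comp G p == i] is Some p
  then [seq q.2 | q <- orbit (next G) p & nonself q.1] else [::].

Definition fhat_comp (G : gauss_code) (i : 'I_2) : cyclic_word :=
  (\pi_cyclic_word (ou_word G i))%qT.

(* K_1 is the component with index 0. *)
Definition fhat (D : diagram) : cyclic_word * cyclic_word :=
  (fhat_comp D ord0, fhat_comp D ord_max).

Definition lift_passage (X Y : Type) (f : X -> Y) (p : passage X) : passage Y :=
  (f p.1, p.2).

(* D' is D with the crossings in S erased (and the others renamed): the        *)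
(* passage following p in D' is the first one after p in D outside of S.       *)
(* For S = set0 this is isomorphism of diagrams.                               *)
Definition erased (D : gauss_code) (S : {set crossing D}) (D' : gauss_code)
    : Prop :=
  exists f : crossing D' -> crossing D,
    let fp := lift_passage f in
    [/\ injective f, (forall c, c \notin S <-> exists x, f x = c),
        (forall x, sign D' x = sign D (f x)),
        (forall p, comp D' p = comp D (fp p)) &
        forall p, exists k, fp (next D' p) = iter k.+1 (next D) (fp p) /\
          forall j, j < k -> (iter j.+1 (next D) (fp p)).1 \in S].

(* Removal of a kink; an edge joining the two passages of one crossing always  *)
(* bounds a monogon.                                                           *)
Definition reidemeister1 (D D' : gauss_code) : Prop :=
  exists (c : crossing D) (b : bool),
    next D (c, b) = (c, ~~ b) /\ erased [set c]%SET D'.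

(* Removal of a bigon whose one side passes over the other at both corners.    *)
(* Two such edges bound a bigon if and only if the crossings have opposite     *)
(* signs.                                                                      *)
Definition reidemeister2 (D D' : gauss_code) : Prop :=
  exists c d : crossing D,
    [/\ next D (c, true) = (d, true),
        next D (c, false) = (d, false) \/ next D (d, false) = (c, false),
        sign D c != sign D d & erased [set c; d]%SET D'].

Definition swap_edge (D : gauss_code) (d : half_edge D)
    : {perm passage (crossing D)} :=
  tperm d.1 (opposite d).1.

(* A triangular face with three distinct corners, one side of which is over    *)
(* at both ends (so that the three strands are stacked): along each strand the *)
(* order of the two corners is exchanged, and the signs are unchanged.         *)
Definition reidemeister3 (D D' : gauss_code) : Prop :=
  exists (d : half_edge D) (f : crossing D' -> crossing D),
    let d1 := face_step d in
    let d2 := face_step d1 in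
    let tau := (swap_edge d * swap_edge d1 * swap_edge d2)%g in
    let fp := lift_passage f in
    [/\ face_step d2 = d,
        uniq [:: d.1.1; d1.1.1; d2.1.1],
        d.1.2 && (opposite d).1.2,
        bijective f &
        [/\ forall x, sign D' x = sign D (f x),
            forall p, comp D' p = comp D (fp p) &
            forall p, fp (next D' p) = tau (next D (tau (fp p)))]].

(* Reflection of the sphere *)
Definition mirrored (D D' : gauss_code) : Prop :=
  exists f : crossing D' -> crossing D,
    let fp := lift_passage f in
    [/\ bijective f, forall x, sign D' x = ~~ sign D (f x),
        forall p, comp D' p = comp D (fp p) &
        forall p, fp (next D' p) = next D (fp p)].

(* Reversal of the orientation of the component i *)
Definition reversed (i : 'I_2) (D D' : gauss_code) : Prop :=
  exists f : crossing D' -> crossing D,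
    let fp := lift_passage f in
    [/\ bijective f,
        forall x, sign D' x =
          sign D (f x) (+) (comp D' (x, true) == i) (+) (comp D' (x, false) == i),
        forall p, comp D' p = comp D (fp p) &
        forall p, fp (next D' p) =
          if comp D' p == i then (next D)^-1%g (fp p) else next D (fp p)].

(* Exchange of the order of the components *)
Definition reordered (D D' : gauss_code) : Prop :=
  exists f : crossing D' -> crossing D,
    let fp := lift_passage f in
    [/\ bijective f, forall x, sign D' x = sign D (f x),
        forall p, comp D' p = rev_ord (comp D (fp p)) &
        forall p, fp (next D' p) = next D (fp p)].

Inductive link_step (D D' : diagram) : Prop :=
| StepIso of erased (D := D) finset.set0 D'
| StepR1 of reidemeister1 D D'
| StepR2 of reidemeister2 D D'
| StepR3 of reidemeister3 D D'
| StepMirror of mirrored D D'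
| StepReverse i of reversed i D D'
| StepReorder of reordered D D'.

(* D and D' represent the same link, up to mirror image and regardless of the  *)
(* orientations and of the order of the components.                            *)
Definition same_link : diagram -> diagram -> Prop :=
  clos_refl_sym_trans diagram link_step.

Definition torus_next_fun n (p : passage 'I_(2 * n)) : passage 'I_(2 * n) :=
  (ordS p.1, ~~ p.2).

Lemma torus_next_inj n : injective (@torus_next_fun n).
Proof.
move=> [i b] [j c] e; have /ordS_inj /= -> := congr1 fst e.
by have /negb_inj /= -> := congr1 snd e.
Qed.

Definition parity_ord (b : bool) : 'I_2 := if b then ord_max else ord0.

(* The closure of the 2-braid sigma_1 ^ (2n), whose strands run in parallel:   *)
(* the crossings are met in the cyclic order 0, 1, ..., 2n-1 by both           *)
(* components, alternately over and under.                                     *)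
Definition torus_code (n : nat) : gauss_code :=
  @GaussCode (2 * n) (perm (@torus_next_inj n)) (fun=> true)
    (fun p => parity_ord (p.2 (+) odd p.1)).

Lemma iter_ordS m (i : 'I_m) k : val (iter k (@ordS m) i) = (i + k) %% m.
Proof.
elim: k => [|k IH]; first by rewrite addn0 modn_small.
by rewrite iterS /= IH -addn1 modnDml addn1 addnS.
Qed.

Lemma iter_ordS_to m (i j : 'I_m) : iter (j + m - i) (@ordS m) i = j.
Proof.
apply: val_inj; rewrite iter_ordS subnKC ?modnDr ?modn_small //.
by rewrite (leq_trans (ltnW (ltn_ord i))) ?leq_addl.
Qed.

Lemma n_comp_labels (T L : finType) (e : rel T) (g : T -> L) (s : L -> T) :
  cancel s g -> (forall x y, connect e x y = (g x == g y)) ->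
  n_comp e predT = #|L|.
Proof.
move=> sK eg; have sym : connect_sym e by move=> x y; rewrite !eg eq_sym.
have rinj : injective (root e \o s).
  by move=> a b /= /(rootP sym); rewrite eg !sK => /eqP.
rewrite /n_comp_mem -(card_codom rinj); apply: eq_card => x.
rewrite !inE andbT; apply/idP/codomP => [/eqP rx|[a ->]] /=; last exact: roots_root.
by exists (g x); rewrite -[LHS]rx; apply/(rootP sym); rewrite eg sK.
Qed.

Lemma torus_comp_correct n : comp_correct (torus_code n).
Proof.
move=> [i b] [j c]; set N := next _.
have NE p : N p = torus_next_fun p by rewrite /N permE.
have itN k : iter k N (i, b) = (iter k (@ordS _) i, b (+) odd k).
  elim: k => [|k IH]; first by rewrite addbF.
  by rewrite !iterS IH NE /torus_next_fun /= addbN.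
have -> : (comp (torus_code n) (i, b) == comp (torus_code n) (j, c)) =
    (b (+) odd i == c (+) odd j) by rewrite /=; do 2![case: (_ (+) _)].
apply/eqP/idP => [e|/iter_findex].
  have <- : iter (j + 2 * n - i) N (i, b) = (j, c).
    rewrite itN iter_ordS_to; congr (_, _).
    rewrite oddB; last by rewrite (leq_trans (ltnW (ltn_ord i))) ?leq_addl.
    rewrite oddD oddM addbF addbA addbAC e -addbA addbb addbF //.
  exact: fconnect_iter.
rewrite itN; move: (findex _ _ _) => k [] /(congr1 val); rewrite iter_ordS => /(congr1 odd) /=.
rewrite odd_mod ?oddM // oddD => <- <-.
by clear; case: b; case: (odd i); case: (odd k).
Qed.

Lemma torus_face_step n (i : 'I_(2 * n)) b out :
  face_step (G := torus_code n) ((i, b), out) =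
    ((if out then ordS i else ord_pred i, b), out (+) ~~ b).
Proof.
rewrite /face_step /opposite /=; case: out.
  by rewrite permE /torus_next_fun /= !negbK.
have -> : (perm (@torus_next_inj n))^-1%g (i, b) = (ord_pred i, ~~ b).
  by apply: (canLR (permK _)); rewrite permE /torus_next_fun /= ord_predK negbK.
by rewrite /= !negbK; case: b.
Qed.

Lemma torus_spherical n : spherical (torus_code n).
Proof.
rewrite /spherical /= card_ord; case: n => [|n].
  have X0 : #|'I_(2 * 0)| = 0 by rewrite card_ord.
  rewrite /n_comp_mem !eq_card0 // => [c|[[c b] o]];
    by have := fintype0 c X0.
set G := torus_code _.
have -> : n_comp (@adjacent G) predT = #|{: unit}|.
  have z : 'I_(2 * n.+1) by exists 0.
  apply: (@n_comp_labels _ _ _ (fun=> tt) (fun=> z)) => [[]//|i j].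
  rewrite eqxx; have <- := iter_ordS_to i j.
  elim: (_ - _) => [|k IH]; first exact: connect0.
  rewrite iterS; apply: connect_trans IH (connect1 _).
  apply/existsP; exists true; apply/existsP; exists false.
  by rewrite permE /torus_next_fun /= eqxx.
rewrite card_unit muln1.
pose g (d : half_edge G) : 'I_(2 * n.+1) + bool :=
  let: ((i, b), out) := d in
  if b then inr out else inl (if out then i else ord_pred i).
pose s (l : 'I_(2 * n.+1) + bool) : half_edge G :=
  match l with inl i => ((i, false), true)
             | inr out => ((@Ordinal (2 * n.+1) 0 isT, true), out) end.
have -> : fcard (@face_step G) predT = #|{: 'I_(2 * n.+1) + bool}|.
  apply: (@n_comp_labels _ _ _ g s) => [[i|o]//|x y].
  have gstep d : g (face_step d) = g d.
    by case: d => [[i []] []]; rewrite torus_face_step /= ?ordSK.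
  apply/idP/eqP => [/iter_findex <-|].
    by elim: (findex _ _ _) => //= k ->; rewrite gstep.
  have itT k (i : 'I_(2 * n.+1)) : iter k (@face_step G) ((i, true), true) =
      ((iter k (@ordS _) i, true), true).
    by elim: k => //= k ->; rewrite torus_face_step.
  have itF k (i : 'I_(2 * n.+1)) : iter k (@face_step G) ((i, true), false) =
      ((iter k (@ord_pred _) i, true), false).
    by elim: k => //= k ->; rewrite torus_face_step.
  case: x => [[i []] o]; case: y => [[j []] o'] //= [].
    move=> <-; case: o.
      by rewrite -(iter_ordS_to i j) -itT fconnect_iter.
    have -> : i = iter (i + 2 * n.+1 - j) (@ordS _) j by rewrite iter_ordS_to.
    set k := _ - _.
    have {2}-> : j = iter k (@ord_pred _) (iter k (@ordS _) j).
      by elim: k => // k IH; rewrite iterSr iterS ordSK.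
    by rewrite -itF fconnect_iter.
  have bigon (k : 'I_(2 * n.+1)) :
      [/\ face_step (G := G) ((k, false), true) = ((ordS k, false), false) &
          face_step (G := G) ((ordS k, false), false) = ((k, false), true)].
    by rewrite !torus_face_step /= ordSK.
  case: o o' => [] [].
  - by move=> ->; apply: connect0.
  - by move=> ->; apply: connect1; rewrite /= (bigon _).1 ord_predK.
  - by move=> <-; apply: connect1; rewrite /= -{1}[i]ord_predK (bigon _).2.
  by move=> /ord_pred_inj ->; apply: connect0.
by rewrite card_sum card_ord card_bool.
Qed.

Definition torus_diagram (n : nat) : diagram :=
  Diagram (@torus_comp_correct n) (@torus_spherical n).

(* All oriented diagrams of T(2,2n) or its mirror image *)
Definition torus_diagrams (n : nat) : set diagram :=
  [set D | same_link (torus_diagram n) D]%classic.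

(* Main.v *)
Require Import Defs.
From mathcomp Require Import order ssralg ssrnum ssrint.

Set Implicit Arguments.
Unset Strict Implicit.
Unset Printing Implicit Defensive.

Import Order.TTheory GRing.Theory Num.Theory.

(** The linking number separates the sets. The sum of the signs of the
    non-self crossings is twice the linking number: its absolute value is
    unchanged by Reidemeister moves, reflection, reversal of a component and
    reordering ([same_link_linking_sum]), and for T(2,2n) it equals 2n
    ([torus_linking_sum]). A sum of signs is at most the number of its terms,
    and each non-self crossing contributes exactly one letter to the word of
    each component ([size_ou_word]); hence every word read off a diagram of
    T(2,2n) has at least 2n letters. The standard diagram of T(2,2m) has words
    with exactly 2m letters, so for m < n its pair of words is not read off any
    diagram of T(2,2n). *)

(** Twice the linking number *)
Definition linking_sum (G : gauss_code) : int :=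
  (\sum_(c : crossing G | nonself c) (-1) ^+ (~~ sign G c))%R.

Lemma linking_sum_le (G : gauss_code) :
  `|linking_sum G| <= #|@nonself G|.
Proof.
rewrite -lez_nat abszE; apply: le_trans (ler_norm_sum _ _ _) _.
by under eq_bigr do rewrite normr_sign; rewrite sumr_const natz.
Qed.

Lemma ord2_neq (i x y : 'I_2) : x != y -> (x == i) = (y != i).
Proof. by case: x y i => [[|[]]] // ? [[|[]]] // ? [[|[]]]. Qed.

(** A non-self crossing has exactly one passage on each of the two components. *)
Lemma size_ou_word (D : diagram) (i : 'I_2) : size (ou_word D i) = #|@nonself D|.
Proof.
have -> : size (ou_word D i) =
    #|[pred q : passage (crossing D) | (comp D q == i) && nonself q.1]|.
  rewrite /ou_word; case: pickP => [p /eqP pi|noi]; last first.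
    by rewrite eq_card0 // => q; rewrite inE noi.
  rewrite size_map cardE; apply/perm_size/uniq_perm; rewrite ?enum_uniq //.
    exact/filter_uniq/orbit_uniq.
  move=> q; rewrite mem_filter mem_enum inE -fconnect_orbit andbC; congr andb.
  by case: D p pi q => G /= compG _ p pi q; rewrite -compG pi eq_sym.
pose on_i (c : crossing D) := (c, comp D (c, true) == i).
have on_i_inj : injective on_i by move=> c d [].
rewrite -(card_image on_i_inj); apply: eq_card => -[c b]; rewrite !inE.
have two (d : crossing D) : nonself d ->
    (comp D (d, true) == i) = (comp D (d, false) != i) by move/ord2_neq.
apply/andP/mapP => [[/eqP ci nc]|[d]]; rewrite /on_i.
  exists c; first by rewrite mem_enum.
  case: b ci nc => /= ci nc; first by rewrite ci eqxx.
  by rewrite two // ci eqxx.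
rewrite mem_enum => nd [-> ->]; split=> //.
have := two d nd; case e: (comp D (d, true) == i); first by rewrite e.
by move/esym/negbFE.
Qed.

(** The common form of all the moves: the crossings in [S] disappear, the
    others are renamed and the signs of all the non-self ones among them are
    changed simultaneously if [b] holds. *)
Lemma linking_sum_transfer (G G' : gauss_code) (S : {set crossing G})
    (f : crossing G' -> crossing G) (b : bool) :
    injective f -> (forall c, c \notin S <-> exists x, f x = c) ->
    (forall x, nonself x = nonself (f x)) ->
    (forall x, nonself x -> sign G' x = sign G (f x) (+) b) ->
  (linking_sum G = \sum_(c in S | nonself c) (-1) ^+ (~~ sign G c)
                   + (-1) ^+ b * linking_sum G')%R.
Proof.
move=> f_inj imf nsf sgf; rewrite /linking_sum (bigID (mem S)) /=; congr (_ + _)%R.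
  by apply: eq_bigl => c; rewrite andbC.
transitivity (\sum_(c in f @: [set x | nonself x]) (-1) ^+ (~~ sign G c) : int)%R.
  apply: eq_bigl => c; apply/andP/imsetP => [[nc /imf [x fx]]|[x]].
    by exists x; rewrite // inE nsf fx.
  by rewrite inE nsf => nx ->; split=> //; apply/imf; exists x.
rewrite big_imset /=; last by move=> x y _ _ /f_inj.
rewrite mulr_sumr; apply: eq_big => [x|x]; rewrite inE // => /sgf ->.
by rewrite -signr_addb -addNb [b (+) _]addbC addbK.
Qed.

Lemma linking_sum_bij (G G' : gauss_code) (f : crossing G' -> crossing G)
    (b : bool) :
    bijective f -> (forall x, nonself x = nonself (f x)) ->
    (forall x, nonself x -> sign G' x = sign G (f x) (+) b) ->
  `|linking_sum G| = `|linking_sum G'|.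
Proof.
move=> f_bij nsf sgf; have [g _ gK] := f_bij.
rewrite (linking_sum_transfer (S := finset.set0) (bij_inj f_bij) _ nsf sgf).
  by rewrite big_pred0 => [|c]; rewrite ?inE // add0r abszMsign.
by move=> c; rewrite inE; split=> // _; exists (g c).
Qed.

Lemma linking_sum_erased (G G' : gauss_code) (S : {set crossing G}) :
    erased S G' ->
    (\sum_(c in S | nonself c) (-1) ^+ (~~ sign G c) = 0 :> int)%R ->
  `|linking_sum G| = `|linking_sum G'|.
Proof.
case=> f [f_inj imf sgf cf _] S0.
rewrite (linking_sum_transfer (b := false) f_inj imf).
- by rewrite S0 add0r mul1r.
- by move=> x; rewrite /nonself !cf.
- by move=> x _; rewrite addbF.
Qed.

Lemma comp_next (D : diagram) p : comp D (next D p) = comp D p.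
Proof.
case: D p => G /= compG _ p; apply/esym/eqP; rewrite compG; exact: fconnect1.
Qed.

Lemma link_step_linking_sum (D D' : diagram) :
  link_step D D' -> `|linking_sum D| = `|linking_sum D'|.
Proof.
case=> [er|[c [b [kink er]]]|[c [d [over under sg er]]]
       |[? [f [_ _ _ f_bij [sgf cf _]]]]|[f [f_bij sgf cf _]]
       |i [f [f_bij sgf cf _]]|[f [f_bij sgf cf _]]].
- by apply: linking_sum_erased er _; rewrite big_pred0 // => c; rewrite inE.
- (* the two passages of a kink are consecutive, hence on one component *)
  apply: linking_sum_erased er _; rewrite big_pred0 // => x; rewrite !inE.
  case: eqP => //= ->; apply/negbTE; rewrite negbK.
  by move: (comp_next (c, b)); rewrite kink; case: b {kink} => /= ->.
- (* the corners of the bigon lie on the same two strands and cancel *)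
  apply: linking_sum_erased er _.
  have neq_cd : c != d by apply: contraNneq sg => ->.
  have nscd : nonself c = nonself d.
    rewrite /nonself -(comp_next (c, true)) over.
    case: under => under; first by rewrite -(comp_next (c, false)) under.
    by rewrite -(comp_next (d, false)) under.
  case nd: (nonself d).
    rewrite (bigD1 c) /= ?inE ?eqxx ?nscd // (bigD1 d) /=; last first.
      by rewrite !inE eqxx orbT nd eq_sym.
    rewrite big_pred0 => [|x]; last first.
      by rewrite !inE; case: (x =P c); case: (x =P d); rewrite ?andbF.
    by case: (sign D c) (sign D d) sg => [] [].
  rewrite big_pred0 // => x; rewrite !inE.
  by case: eqP => [->|_]; [rewrite nscd nd andbF | case: eqP => [->|]].
- apply: (linking_sum_bij (b := false) f_bij) => x; first by rewrite /nonself !cf.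
  by rewrite addbF.
- apply: (linking_sum_bij (b := true) f_bij) => x; first by rewrite /nonself !cf.
  by rewrite sgf addbT.
- (* exactly one strand of a non-self crossing is reversed *)
  apply: (linking_sum_bij (b := true) f_bij) => x; first by rewrite /nonself !cf.
  by move=> /(ord2_neq i) two; rewrite sgf -addbA two addNb addbb.
- apply: (linking_sum_bij (b := false) f_bij) => x.
    by rewrite /nonself !cf (inj_eq rev_ord_inj).
  by rewrite addbF.
Qed.

Lemma same_link_linking_sum (D D' : diagram) :
  same_link D D' -> `|linking_sum D| = `|linking_sum D'|.
Proof.
by elim=> [? ? /link_step_linking_sum|//|//|? ? ? _ -> _ ->].
Qed.

Lemma torus_nonself n (c : crossing (torus_code n)) : nonself c.
Proof. by rewrite /nonself /=; case: odd. Qed.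

Lemma card_torus_nonself n : #|@nonself (torus_code n)| = 2 * n.
Proof.
by rewrite -[RHS]card_ord; apply: eq_card => c; rewrite [LHS]torus_nonself.
Qed.

Lemma torus_linking_sum n : linking_sum (torus_code n) = Posz (2 * n).
Proof. by rewrite /linking_sum sumr_const card_torus_nonself natz. Qed.

Lemma size_fhat_comp (G G' : gauss_code) (i : 'I_2) :
  fhat_comp G i = fhat_comp G' i -> size (ou_word G i) = size (ou_word G' i).
Proof. by case/eqmodP/cyc_relP=> k <-; rewrite size_rot. Qed.

(** Words coming from T(2,2n) have at least 2n letters, whereas the standard
    diagram of T(2,2m) gives words with 2m letters. *)
Lemma fhat_torus_subset_leq (n m : nat) :
  (fhat @` torus_diagrams m `<=` fhat @` torus_diagrams n)%classic -> n <= m.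
Proof.
move=> sub; have [|D nD /(congr1 fst) /= e] := sub (fhat (torus_diagram m)).
  by exists (torus_diagram m) => //; apply: rst_refl.
have := size_fhat_comp e.
rewrite (size_ou_word (torus_diagram m)) size_ou_word card_torus_nonself => szD.
rewrite -(leq_pmul2l (isT : 0 < 2)) -szD.
by have := linking_sum_le D; rewrite -(same_link_linking_sum nD) torus_linking_sum.
Qed.

Theorem theorem4 (n m : nat) (hn : 0 < n) (hm : 0 < m) (hnm : n <> m) :
  (fhat @` torus_diagrams n <> fhat @` torus_diagrams m)%classic.
Proof.
move=> e; apply: hnm; apply/eqP; rewrite eqn_leq.
by rewrite !fhat_torus_subset_leq // e.
Qed.
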